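(* Let $A,B\in\mathbb Z$ and $\Delta=A^2-4B$. Let $p$ be an odd prime with $p\nmid AB$ and $\left(\frac{\Delta}p\right)=1$. Then $$\sum_{k=0}^{p-1}\frac{A^kv_k(A,B)}{(4B)^k}\binom{2k}k\equiv2\left(\frac{-B}p\right)\pmod{p^2}.$$
   Context: For $A,B\in\mathbb Z$ the Lucas sequence $v_n=v_n(A,B)$ is defined by $v_0=2$, $v_1=A$, $v_{n+1}=Av_n-Bv_{n-1}$ ($n\ge1$). $\left(\frac{\cdot}{p}\right)$ is the Legendre symbol. Congruences between rationals with denominators prime to $p$ are understood in the ring of such rationals. *)

(* Defs.v *)
From mathcomp Require Import all_boot all_order all_algebra.

Set Implicit Arguments.
Unset Strict Implicit.
Unset Printing Implicit Defensive.

Import Order.TTheory GRing.Theory Num.Theory.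
Local Open Scope ring_scope.

Fixpoint lucas_v (A B : int) (n : nat) : int :=
  match n with
  | 0 => 2
  | 1 => A
  | (m.+1 as n').+1 => A * lucas_v A B n' - B * lucas_v A B m
  end.

(* Meaningful only for an odd prime [p]. *)
Definition legendre (a : int) (p : nat) : int :=
  if (p%:Z %| a)%Z then 0
  else if [exists x : 'I_p, ((x : nat)%:Z ^+ 2 == a %[mod p%:Z])%Z] then 1
  else -1.

(* [denq] is the positive denominator in lowest terms, so for [p] prime this is
   the subring of rationals whose denominator is prime to [p]. *)
Definition plocal (p : nat) : pred rat := fun x => coprime p `|denq x|%N.

(* Congruence modulo [m] in the ring [plocal p]: both sides lie in that ring
   and their difference is a multiple of [m] there. *)
Definition plocal_cong (p m : nat) (x y : rat) : Prop :=
  [/\ plocal p x, plocal p y & exists2 z : rat, plocal p z & x - y = m%:R * z].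

(* Main.v *)
(* Hensel's lemma provides roots [a], [b] of [X^2 - A X + B] in [Z/p^2], and then
   [v_k = a^k + b^k].  With [x = a/b], the summand becomes
   [C(2k,k) (((1 + x)/4)^k + ((1 + 1/x)/4)^k)], so that the sum is
   [F(x) + F(1/x)] for [F(x) = sum_{k<p} C(2k,k) ((1 + x)/4)^k].  The coefficient
   [c_j] of [x^j] in [F] satisfies
   [(2j+1) c_j = (2p-1) C(2p-2,p-1) C(p-1,j) / 4^(p-1)], where [p] divides
   [C(2p-2,p-1)].  Hence, for [j <> n = (p-1)/2], [c_j] is a multiple of [p] and
   [c_j + c_(p-1-j) = 0] modulo [p^2]; by Fermat's little theorem all these terms
   cancel in [F(x) + F(1/x)], which is therefore [c_n (x^n + x^-n)].  Taking
   [x = -1], where [F = 1], gives [c_n = (-1)^n].  Finally, [(-x)^n] is congruent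
   modulo [p] to the Legendre symbol [l] of [- a b = - B], so that
   [(-x)^n + (-x)^-n = 2 l] modulo [p^2]. *)
Require Import Defs.
From mathcomp Require Import all_boot all_order all_algebra.
From mathcomp Require Import all_solvable all_field.
From mathcomp Require Import zify ring.

Import Order.TTheory GRing.Theory Num.Theory.
Local Open Scope ring_scope.

(** * Closed form of the coefficients *)

(** Divided by [4^(N+1)], this is the increment of [(2N+1) C(2N,N) C(N,j) / 4^N] from [N] to [N+1].
    All central binomials are expressed through [C(2N+1,N)]. *)
Lemma central_bin_step N j :
  ((2 * N.+1).+1 * 'C(2 * N.+1, N.+1) * 'C(N.+1, j) =
   4 * ((2 * N).+1 * 'C(2 * N, N) * 'C(N, j)) +
   (2 * j).+1 * ('C(2 * N.+1, N.+1) * 'C(N.+1, j)))%N.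
Proof.
have [ltj|lej] := ltnP N.+1 j.
  by rewrite (bin_small ltj) (@bin_small N j) 1?ltnW // !muln0.
have eC : 'C(2 * N.+1, N.+1) = (2 * 'C((2 * N).+1, N))%N.
  have := mul_bin_diag (2 * N.+1) N.
  by rewrite (_ : (2 * N.+1).-1 = (2 * N).+1); [nia | lia].
have eD := mul_bin_down (2 * N).+1 N.
have eE := mul_bin_down N.+1 j.
rewrite /= in eD eE; rewrite eC eD.
have -> : ((2 * N).+1 - N = N.+1)%N by lia.
have -> : (4 * (N.+1 * 'C((2 * N).+1, N) * 'C(N, j)) =
  4 * 'C((2 * N).+1, N) * (N.+1 * 'C(N, j)))%N by lia.
rewrite eE.
have -> : N.+1 = (N.+1 - j + j)%N by lia.
move: (N.+1 - j)%N => m; rewrite addnK.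
move: 'C(_, _) => a; move: 'C(_, _) => b; nia.
Qed.

(** The coefficient of [x^j] in the sum of [C(2k,k) ((1+x)/4)^k] over [k < N]. *)
Definition cbin_coef (R : comUnitRingType) (N j : nat) : R :=
  \sum_(0 <= k < N) ('C(2 * k, k) * 'C(k, j))%:R / 4 ^+ k.

(* [(2 j + 1) * summand k] telescopes in [k]. *)
Lemma cbin_coefE (R : comUnitRingType) N j : (4 : R) \is a GRing.unit ->
  (2 * j).+1%:R * cbin_coef R N.+1 j =
    ((2 * N).+1 * 'C(2 * N, N) * 'C(N, j))%:R / 4 ^+ N.
Proof.
move=> u4; rewrite /cbin_coef; elim: N => [|N IHN].
  rewrite big_nat1 !expr0 !divr1 -natrM; congr (_%:R).
  by case: j => [|j]; rewrite ?muln0 // bin0n !muln0.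
rewrite big_nat_recr //= mulrDr IHN central_bin_step natrD mulrDl; congr (_ + _).
  by rewrite [(4 * _)%:R]natrM exprS invrM ?unitrX // [_ * (_ * _)%:R]mulrC -mulrA
             [4%:R * (_ * _)]mulrCA divrr // mulr1.
by rewrite [in RHS]natrM mulrA.
Qed.

Lemma sum_cbin_expand (R : comUnitRingType) N (x : R) :
  (4 : R) \is a GRing.unit ->
  \sum_(0 <= k < N) 'C(2 * k, k)%:R * ((1 + x) / 4) ^+ k =
    \sum_(0 <= j < N) cbin_coef R N j * x ^+ j.
Proof.
move=> u4; under [RHS]eq_bigr do rewrite /cbin_coef mulr_suml.
rewrite exchange_big_nat /=; apply: eq_big_nat => k /andP[_ ltkN].
rewrite exprMn exprDn mulrA mulr_sumr mulr_suml.
rewrite (big_ord_widen N (fun i => 'C(2 * k, k)%:R *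
  (1 ^+ (k - i) * x ^+ i *+ 'C(k, i)) * 4^-1 ^+ k)) // big_mkcond /= big_mkord.
apply: eq_bigr => i _; case: ifPn => [_|]; last first.
  by rewrite -leqNgt => /bin_small ->; rewrite muln0 !mul0r.
by rewrite expr1n mul1r natrM exprVn -mulr_natr; ring.
Qed.

(** A Bezout relation [u m + v q = 1] becomes [u m = 1] once [q] vanishes in [R]. *)
Lemma intr_unit (R : comUnitRingType) (q : nat) (m : int) :
  q%:R = 0 :> R -> coprimez m q -> (m%:~R : R) \is a GRing.unit.
Proof.
move=> q0 /coprimezP[[u v] /= /(congr1 (fun z => z%:~R : R))].
rewrite rmorphD !rmorphM /= -[q%:~R]/(q%:R) q0 mulr0 addr0 => um1.
by apply/unitrPr; exists u%:~R; rewrite mulrC.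
Qed.

(** * Symmetry of the coefficients when [p^2 = 0] *)

Section Symmetric.

Variables (R : comUnitRingType) (n : nat).
Local Notation p := n.*2.+1.
Hypotheses (p_prime : prime p) (p2_0 : p%:R ^+ 2 = 0 :> R).

Let natr_unit m : coprime m p -> (m%:R : R) \is a GRing.unit.
Proof.
move=> cmp; apply: (intr_unit R (p ^ 2) m); first by rewrite natrX.
by rewrite coprimezE /= coprimeXr.
Qed.

Let unit2 : (2 : R) \is a GRing.unit.
Proof. by apply: natr_unit; rewrite prime_coprime // dvdn2 /= odd_double. Qed.

Let unit4 : (4 : R) \is a GRing.unit.
Proof. by rewrite (natrM R 2 2) unitrM unit2. Qed.

(** The only odd multiple of [p] below [2p] is [p] itself, reached at [j = n]. *)
Let odd_unit j : (j < p)%N -> j != n -> ((2 * j).+1%:R : R) \is a GRing.unit.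
Proof.
move=> ltjp nej; apply: natr_unit; rewrite coprime_sym prime_coprime //.
apply: contra nej => /dvdnP[[|[|q]] e]; lia.
Qed.

Local Notation c := (cbin_coef R p).

Lemma cbin_coef_dvd j : (j < p)%N -> j != n -> exists d, c j = p%:R * d.
Proof.
move=> ltjp nej.
have uj := odd_unit _ ltjp nej.
have cbin_dvd : (p %| (2 * n.*2).+1 * 'C(2 * n.*2, n.*2))%N.
  (* [(2p-1) C(2p-2,p-1) = p C(2p-1,p)]. *)
  have := mul_bin_diag (2 * n.*2).+1 n.*2.
  by rewrite /= => ->; apply: dvdn_mulr.
have /dvdnP[m em] := cbin_dvd.
have := cbin_coefE R n.*2 j unit4; rewrite em => e.
exists ((2 * j).+1%:R^-1 * ((m * 'C(n.*2, j))%:R / 4 ^+ n.*2)).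
rewrite mulrCA; apply: (canRL (mulKr uj)); rewrite e !natrM.
by ring.
Qed.

(** Since [C(p-1,j)] is symmetric, the closed form gives [(2j+1) c_j = (2p - (2j+1)) c_(p-1-j)], and
    [2p] kills [c_(p-1-j)], a multiple of [p]. *)
Lemma cbin_coef_rev j : (j < p)%N -> j != n -> c (n.*2 - j) = - c j.
Proof.
move=> ltjp nej.
have uj := odd_unit _ ltjp nej.
have [d ed] := cbin_coef_dvd (n.*2 - j) ltac:(lia) ltac:(lia).
have := cbin_coefE R n.*2 j unit4.
rewrite -(@bin_sub n.*2 j ltjp) -(cbin_coefE _ _ _ unit4).
have -> : (2 * (n.*2 - j)).+1 = (2 * p - (2 * j).+1)%N by lia.
rewrite natrB; last lia.
rewrite mulrBl natrM -mulrA ed [p%:R * (p%:R * d)]mulrA -expr2 p2_0 mul0r mulr0.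
by rewrite sub0r -mulrN => /(mulrI uj) ->; rewrite opprK.
Qed.

(** The second hypothesis is Fermat's theorem multiplied by [p]: next to a coefficient divisible by
    [p], it turns [x^(p-1-j)] into [x^-j]. *)
Lemma sum_cbin_coef_sym (x : R) : x \is a GRing.unit ->
    p%:R * x ^+ n.*2 = p%:R ->
  \sum_(0 <= j < p) c j * (x ^+ j + x ^- j) = c n * (x ^+ n + x ^- n).
Proof.
move=> ux px; rewrite big_mkord.
have ltnp : (n < p)%N by lia.
rewrite (bigD1 (Ordinal ltnp)) //=; set S := \sum_(i < _ | _) _.
(* Reversing the index negates the coefficients and keeps the other factors; [2] is invertible. *)
suff S0 : S = - S.
  have : 2 * S = 0 by rewrite mulr_natl mulr2n {1}S0 addNr.
  by move/(canRL (mulKr unit2)) ->; rewrite mulr0 addr0.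
rewrite {1}/S (reindex_inj rev_ord_inj) /= -sumrN.
apply: eq_big => [i|i nei]; have lip := ltn_ord i.
  by rewrite -!val_eqE /=; lia.
have {}nei : (i : nat) != n by move: nei; rewrite -!val_eqE /=; lia.
rewrite subSS cbin_coef_rev // mulNr; congr (- _).
have [d ->] := cbin_coef_dvd _ lip nei.
have ex : x ^+ n.*2 = x ^+ (n.*2 - i) * x ^+ i by rewrite -exprD subnK.
have pxN : p%:R * x ^+ (n.*2 - i) = p%:R * x ^- i.
  by rewrite -[in RHS]px ex mulrA mulrK // unitrX.
have pxV : p%:R * x ^- (n.*2 - i) = p%:R * x ^+ i.
  by rewrite -[in LHS]px ex mulrCA mulrC mulKr ?unitrX // mulrC.
by rewrite ![_ * d]mulrC -!mulrA; congr (d * _); rewrite !mulrDr pxN pxV addrC.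
Qed.

Lemma cbin_coef_mid : c n = (-1) ^+ n.
Proof.
have := sum_cbin_coef_sym (-1).
rewrite unitrN unitr1 -[_ ^+ n.*2]signr_odd odd_double mulr1 => /(_ isT erefl).
rewrite invr_sign; under eq_bigr do rewrite invr_sign mulrDr.
rewrite big_split /= -sum_cbin_expand // addrN mul0r.
(* The base [(1 - 1)/4] is zero, so only [k = 0] contributes. *)
rewrite big_nat_recl //= big1 ?addr0 => [|i _]; last by rewrite expr0n mulr0.
rewrite muln0 bin0 expr0 mulr1; set s := (-1) ^+ n.
have -> : 1 + 1 = 2 * 1 :> R by ring.
have -> : c n * (s + s) = 2 * (c n * s) by ring.
move/(mulrI unit2)/(congr1 ( *%R^~ s)).
by rewrite mul1r -mulrA -expr2 sqrr_sign mulr1.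
Qed.

Lemma sum_cbin_sym (x : R) : x \is a GRing.unit ->
    p%:R * x ^+ n.*2 = p%:R ->
  \sum_(0 <= k < p) 'C(2 * k, k)%:R *
     (((1 + x) / 4) ^+ k + ((1 + x^-1) / 4) ^+ k) = (- x) ^+ n + (- x) ^- n.
Proof.
move=> ux px; under eq_bigr do rewrite mulrDr.
rewrite big_split /= !sum_cbin_expand // -big_split /=.
under eq_bigr do rewrite exprVn -mulrDr.
rewrite sum_cbin_coef_sym // cbin_coef_mid [in RHS]exprNn.
rewrite mulrDr; congr (_ + _).
by rewrite invrM ?unitrX ?unitrN ?unitr1 // invr_sign mulrC.
Qed.

End Symmetric.

(** * Fermat's theorem and Euler's criterion modulo [p] *)

Lemma Fp_expf_pred p (x : 'F_p) : prime p -> x != 0 -> x ^+ p.-1 = 1.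
Proof.
move=> pp x0; apply: (mulfI x0); rewrite mulr1 -exprS prednK ?prime_gt0 //.
by rewrite -[X in x ^+ X](card_Fp pp) expf_card.
Qed.

(** The [p-1] nonzero elements are all roots of [X^(p-1) - 1], so one of them is primitive. *)
Lemma Fp_prim_root p : prime p -> exists z : 'F_p, p.-1.-primitive_root z.
Proof.
move=> pp.
have /hasP[z _ zP] : has p.-1.-primitive_root (enum (predC1 (0 : 'F_p))).
  apply: has_prim_root; rewrite ?enum_uniq //.
  - by rewrite -subn1 subn_gt0 prime_gt1.
  - apply/allP => x; rewrite mem_enum inE /= => x0.
    by rewrite unity_rootE Fp_expf_pred.
  - by rewrite -cardE cardC1 card_Fp.
by exists z.
Qed.

Lemma Fp_intr_eq0 p (m : int) : prime p -> (m%:~R == 0 :> 'F_p) = (p %| m)%Z.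
Proof. by move=> pp; rewrite -(dvdz_pcharf (pchar_Fp pp)). Qed.

Lemma existsb_sqr_mod p (a : int) : prime p ->
  [exists x : 'I_p, ((x : nat)%:Z ^+ 2 == a %[mod p%:Z])%Z] =
  [exists y : 'F_p, y ^+ 2 == a%:~R].
Proof.
move=> pp; apply/existsP/existsP => [[x ex]|[y ey]].
  exists (x : nat)%:R; move: ex; rewrite eqz_mod_dvd -Fp_intr_eq0 //.
  by rewrite rmorphB rmorphXn subr_eq0.
have lty : (y < p)%N by rewrite -[X in (_ < X)%N](Fp_cast pp) ltn_ord.
exists (Ordinal lty) => /=; rewrite eqz_mod_dvd -Fp_intr_eq0 //.
by rewrite rmorphB rmorphXn subr_eq0 /= -pmulrn natr_Zp.
Qed.

Lemma euler_criterion n (a : int) : prime n.*2.+1 -> ~~ (n.*2.+1%:Z %| a)%Z ->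
  (n.*2.+1%:Z %| a ^+ n - legendre a n.*2.+1)%Z.
Proof.
move=> pp; have n0 : (0 < n)%N by case: n pp.
set p := n.*2.+1 in pp * => pNa; rewrite /legendre (negPf pNa) existsb_sqr_mod //.
rewrite -Fp_intr_eq0 // rmorphB rmorphXn /=.
have a0 : a%:~R != 0 :> 'F_p by rewrite Fp_intr_eq0.
case: existsP => [[y /eqP ey]|sqrN].
  rewrite -ey -exprM mul2n (@Fp_expf_pred p) ?subrr //.
  by apply: contraNneq a0 => y0; rewrite -ey y0 expr0n.
have : (a%:~R ^+ n) ^+ 2 == 1 :> 'F_p.
  by rewrite -exprM muln2 (@Fp_expf_pred p).
rewrite sqrf_eq1 => /orP[/eqP an1|/eqP ->]; last by rewrite subrr.
(* With [a = z^i], [a^n = 1] forces [2n] to divide [i n], so [i] is even and [z^(i/2)] is a square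
   root of [a]. *)
have [z zP] := Fp_prim_root p pp.
have [i ai] := prim_rootP zP (Fp_expf_pred p _ pp a0).
case: sqrN; exists (z ^+ i./2); rewrite -exprM muln2 ai.
move: an1; rewrite ai -exprM => /eqP; rewrite -(prim_order_dvd zP).
rewrite [X in (X %| _)%N](_ : _ = 2 * n)%N; last by rewrite mul2n.
by rewrite dvdn_pmul2r // dvdn2 => /even_halfK ->.
Qed.

Lemma legendre_sqr p (a : int) : ~~ (p%:Z %| a)%Z -> legendre a p ^+ 2 = 1.
Proof. by rewrite /legendre => /negPf ->; case: ifP. Qed.

Lemma legendre1_sqr p (a : int) : legendre a p = 1 ->
  ~~ (p%:Z %| a)%Z /\ exists x : int, (p%:Z %| a - x ^+ 2)%Z.
Proof.
rewrite /legendre; case: ifP => // _; case: existsP => // -[x xa] _.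
by split=> //; exists (x : nat)%:Z; rewrite -eqz_mod_dvd eq_sym.
Qed.

Lemma fermat_intr p (a : int) : prime p -> ~~ (p%:Z %| a)%Z ->
  (p%:Z %| a ^+ p.-1 - 1)%Z.
Proof.
move=> pp pNa; rewrite -Fp_intr_eq0 // rmorphB rmorphXn /= Fp_expf_pred //.
  by rewrite subrr.
by rewrite Fp_intr_eq0.
Qed.

(** * Binet's formula, local rationals and residues modulo [p^2] *)

Lemma lucas_vE (R : comPzRingType) (A B : int) (a b : R) k :
  a + b = A%:~R -> a * b = B%:~R -> (lucas_v A B k)%:~R = a ^+ k + b ^+ k.
Proof.
move=> eA eB; suff [] : (lucas_v A B k)%:~R = a ^+ k + b ^+ k /\
  (lucas_v A B k.+1)%:~R = a ^+ k.+1 + b ^+ k.+1 by [].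
elim: k => [|k [IH IH1]]; first by rewrite /= eA.
split=> //; rewrite -[lucas_v A B k.+2]/(A * lucas_v A B k.+1 - B * lucas_v A B k).
by rewrite rmorphB !rmorphM /= IH IH1 -eA -eB !exprS; ring.
Qed.

(** By Gauss's lemma the reduced denominator of [x] divides any denominator [d]. *)
Lemma plocal_frac p (x : rat) (d m : int) :
  coprime p `|d| -> x * d%:~R = m%:~R -> plocal p x.
Proof.
move=> cpd exd; rewrite /plocal; apply: (coprime_dvdr _ cpd).
have e : numq x * d = m * denq x.
  apply: (@intr_inj rat); rewrite !rmorphM /= -exd numqE; ring.
rewrite -[(_ %| _)%N]/(denq x %| d)%Z -(@Gauss_dvdzr _ (numq x)) ?e ?dvdz_mull //.
by rewrite coprimezE coprime_sym coprime_num_den.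
Qed.

Lemma intr_Zp_eq0 q (m : int) : (1 < q)%N ->
  (m%:~R == 0 :> 'Z_q) = (q %| m)%Z.
Proof.
move=> q1; have natE k : (k%:R == 0 :> 'Z_q) = (q %| k)%N.
  by rewrite -val_eqE /= val_Zp_nat.
by case: m => m; rewrite dvdzE /= -natE // NegzE rmorphN oppr_eq0.
Qed.

Lemma intr_dvd (R : pzRingType) (d m : int) :
  (d %| m)%Z -> exists w : R, m%:~R = d%:~R * w.
Proof.
by case/dvdzP=> k ->; exists k%:~R; rewrite mulrC rmorphM.
Qed.

(** This supplies the assumption [fermatR] below, which does not follow from [p^2 = 0] alone. *)
Lemma fermat_Zp2 p (x : 'Z_(p ^ 2)) : prime p -> x \is a GRing.unit ->
  exists w, x ^+ p.-1 = 1 + p%:R * w.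
Proof.
move=> p_prime ux; have q_gt1 : (1 < p ^ 2)%N.
  by rewrite (ltn_exp2l 0) ?prime_gt1.
have pNx : ~~ (p%:Z %| (x : nat)%:Z)%Z.
  move: ux; rewrite -{1}[x]natr_Zp unitZpE // coprime_pexpl //.
  by rewrite prime_coprime.
have [w] := intr_dvd 'Z_(p ^ 2) _ _ (fermat_intr _ _ p_prime pNx).
rewrite rmorphB rmorphXn /= -!pmulrn natr_Zp => e.
by exists w; rewrite -e addrC subrK.
Qed.

(** * The Lucas sum in a ring where [p^2 = 0] *)

Section LucasSum.

Variables (R : comUnitRingType) (A B : int) (n : nat).
Local Notation p := n.*2.+1.
Hypotheses (p_prime : prime p) (p2_0 : p%:R ^+ 2 = 0 :> R).
Hypothesis fermatR : forall x : R, x \is a GRing.unit ->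
  exists w, x ^+ n.*2 = 1 + p%:R * w.
Hypotheses (pNAB : ~~ (p%:Z %| A * B)%Z).
Hypothesis legD : legendre (A ^+ 2 - 4 * B) p = 1.

Let intrU (m : int) : ~~ (p%:Z %| m)%Z -> (m%:~R : R) \is a GRing.unit.
Proof.
move=> pNm; apply: (intr_unit _ (p ^ 2)); first by rewrite natrX.
by rewrite coprimezE /= coprimeXr // coprime_sym prime_coprime.
Qed.

Let unit2 : (2 : R) \is a GRing.unit.
Proof.
apply: (intrU 2); rewrite dvdzE /=; apply: contraL p_prime => /dvdn_leq.
by case: (n) => [|[|m]] // /(_ isT); lia.
Qed.

(** One Newton step: if the discriminant is [z^2 + p m], the correction [p m / (2z)] has square zero
    and contributes the cross term [p m]. *)
Lemma sqrt_disc : exists s : R, s ^+ 2 = (A ^+ 2 - 4 * B)%:~R.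
Proof.
have [pND [y pDy]] := legendre1_sqr _ _ legD.
have uy : (y%:~R : R) \is a GRing.unit.
  apply: intrU; apply: contra pND => py.
  by rewrite -[A ^+ 2 - 4 * B](subrK (y ^+ 2)) rpredD ?dvdz_exp.
have [m] := intr_dvd R _ _ pDy; rewrite rmorphB => /(canRL (subrK _)) ->.
rewrite rmorphXn /= -pmulrn; set z : R := y%:~R in uy *.
have u2z : 2 * z \is a GRing.unit by rewrite unitrM unit2.
exists (z + p%:R * (m / (2 * z))).
rewrite sqrrD exprMn p2_0 mul0r addr0 addrC; congr (_ + _).
rewrite -[X in _ = _ * X](divrK u2z); ring.
Qed.

(* With [u = (- a / b) ^ n] and [l] the Legendre symbol, [p] divides [u - l],
   so [(u - l) ^ 2 = 0], which together with [l ^ 2 = 1] gives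
   [u + u^-1 = 2 l]. *)
Lemma sum_lucas_cbin :
  \sum_(0 <= k < p)
     (A ^+ k * lucas_v A B k)%:~R / ((4 * B) ^+ k)%:~R * 'C(2 * k, k)%:R =
  (2 * legendre (- B) p)%:~R :> R.
Proof.
have pNB : ~~ (p%:Z %| B)%Z by apply: contra pNAB; apply: dvdz_mull.
have uB : (B%:~R : R) \is a GRing.unit by apply: intrU.
have u4 : (4 : R) \is a GRing.unit by rewrite (natrM R 2 2) unitrM unit2.
have [s es] := sqrt_disc.
pose a : R := (A%:~R + s) / 2; pose b : R := (A%:~R - s) / 2.
have eA : a + b = A%:~R.
  rewrite /a /b -mulrDl addrACA subrr addr0 -[X in _ = X](mulrK unit2).
  by congr (_ / _); ring.
have eB : a * b = B%:~R.
  have e4 : 4 * (a * b) = 4 * B%:~R.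
    transitivity ((2 * 2^-1) ^+ 2 * (A%:~R ^+ 2 - s ^+ 2)).
      by rewrite /a /b; ring.
    rewrite es divrr // expr1n mul1r rmorphB rmorphXn rmorphM /=; ring.
  exact: mulrI u4 _ _ e4.
clearbody a b; have /andP[ua ub] : (a \is a GRing.unit) && (b \is a GRing.unit).
  by rewrite -unitrM eB.
have ux : a / b \is a GRing.unit by rewrite unitrM ua unitrV.
have [w1 ew1] := fermatR _ ux.
have px : p%:R * (a / b) ^+ n.*2 = p%:R.
  by rewrite ew1 mulrDr mulr1 mulrA -expr2 p2_0 mul0r addr0.
(* [A / (4B) = (1/a + 1/b) / 4]; multiplied by [a] or [b] it gives the two bases in [x = a/b]. *)
have ABE : A%:~R / (4 * B%:~R) = (a + b) * (b^-1 * a^-1 / 4).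
  by rewrite -eA -eB invrM ?unitrM ?ua // invrM.
have xE : (1 + a / b) / 4 = A%:~R / (4 * B%:~R) * a.
  rewrite ABE; transitivity ((a + b) / b / 4 * (a / a)).
    by rewrite divrr // mulr1 [in RHS]mulrDl divrr // addrC.
  by ring.
have xVE : (1 + (a / b)^-1) / 4 = A%:~R / (4 * B%:~R) * b.
  rewrite ABE; transitivity ((a + b) / a / 4 * (b / b)).
    by rewrite invrM ?unitrV // invrK !divrr // mulr1 [in RHS]mulrDl divrr.
  by ring.
have -> : \sum_(0 <= k < p)
     (A ^+ k * lucas_v A B k)%:~R / ((4 * B) ^+ k)%:~R * 'C(2 * k, k)%:R =
  \sum_(0 <= k < p) 'C(2 * k, k)%:R *
     (((1 + a / b) / 4) ^+ k + ((1 + (a / b)^-1) / 4) ^+ k) :> R.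
  apply: eq_bigr => k _; rewrite xE xVE mulrC; congr (_ * _).
  rewrite intrM (lucas_vE _ _ _ _ _ _ eA eB) !rmorphXn rmorphM /=.
  by rewrite [in RHS]exprMn [X in _ = _ + X]exprMn -mulrDr expr_div_n mulrAC.
rewrite (sum_cbin_sym R n p_prime p2_0 _ ux px).
set u := (- (a / b)) ^+ n; set l := legendre (- B) p.
have pNNB : ~~ (p%:Z %| - B)%Z by rewrite rpredN.
have uu : u \is a GRing.unit by rewrite unitrX ?unitrN.
have l2 : l%:~R ^+ 2 = 1 :> R by rewrite -rmorphXn legendre_sqr.
have [w2 ew2] := fermatR _ ub.
have [w3] := intr_dvd R _ _ (euler_criterion n (- B) p_prime pNNB).
rewrite -/l rmorphB rmorphXn rmorphN /= -eB -pmulrn => ew3.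
(* Fermat's theorem for [b] and Euler's criterion for [-B = -ab] then give [u = l] modulo [p]. *)
have ub2 : u * b ^+ n.*2 = (- (a * b)) ^+ n.
  rewrite -mul2n exprM -exprMn; congr (_ ^+ n).
  transitivity (- (a * b * (b / b))); first by ring.
  by rewrite divrr // mulr1.
have ul : u - l%:~R = p%:R * (w3 - u * w2).
  by rewrite mulrBr -ew3 -ub2 ew2; ring.
have : (u - l%:~R) ^+ 2 = 0 by rewrite ul exprMn p2_0 mul0r.
rewrite sqrrB l2 => ul2; apply: (mulIr uu).
rewrite mulrDl mulVr // rmorphM /=.
(* The added bracket is [(u - l)^2], with [l^2] replaced by [1]. *)
transitivity (2 * l%:~R * u + (u ^+ 2 - u * l%:~R *+ 2 + 1)); first by ring.
by rewrite ul2 addr0.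
Qed.

End LucasSum.

(** * Return to the rationals *)

Lemma plocal_int p (m : int) : plocal p m%:~R.
Proof. by rewrite /plocal denq_int coprimen1. Qed.

Theorem theorem1p4 (A B : int) (p : nat) (p_prime : prime p) (p_odd : odd p)
    (pNAB : ~~ (p%:Z %| A * B)%Z)
    (legD : legendre (A ^+ 2 - 4 * B) p = 1) :
  plocal_cong p (p ^ 2)
    (\sum_(0 <= k < p)
        (A ^+ k * lucas_v A B k)%:~R / ((4 * B) ^+ k)%:~R * 'C(2 * k, k)%:R)
    (2 * legendre (- B) p)%:~R.
Proof.
have pE : p = p./2.*2.+1 by rewrite -[LHS]odd_double_half p_odd.
have pNB : ~~ (p%:Z %| B)%Z by apply: contra pNAB; apply: dvdz_mull.
have p2 : (2 < p)%N by rewrite odd_prime_gt2.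
have q1 : (1 < p ^ 2)%N by rewrite (ltn_exp2l 0) ?prime_gt1.
have cp4B : coprimez p (4 * B).
  rewrite coprimezMr !coprimezE /= !prime_coprime // pNB andbT.
  by rewrite (Euclid_dvdM 2 2) // orbb gtnNdvd.
set D := (4 * B) ^+ p.-1; set l := (2 * legendre (- B) p).
have cpD : coprimez p D by rewrite coprimezXr.
pose T := \sum_(0 <= k < p)
  A ^+ k * lucas_v A B k * (4 * B) ^+ (p.-1 - k) * 'C(2 * k, k)%:R.
(* Stated over any [K] so as to compare the integer [T] with the sum both in [rat] and in
   ['Z_(p ^ 2)]. *)
have clear_den (K : comUnitRingType) : ((4 * B)%:~R : K) \is a GRing.unit ->
    (\sum_(0 <= k < p) (A ^+ k * lucas_v A B k)%:~R / ((4 * B) ^+ k)%:~R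
       * 'C(2 * k, k)%:R) * D%:~R = T%:~R :> K.
  move=> u4B; rewrite rmorph_sum mulr_suml; apply: eq_big_nat => k /andP[_ ltkp].
  have -> : D = (4 * B) ^+ (p.-1 - k) * (4 * B) ^+ k.
    by rewrite -exprD subnK // -ltnS prednK ?prime_gt0.
  have ud : (((4 * B) ^+ k)%:~R : K) \is a GRing.unit.
    by rewrite rmorphXn unitrX.
  have natE m : (m%:R : int)%:~R = m%:R :> K by rewrite natz -pmulrn.
  rewrite -[RHS](mulrK ud) /= !intrM natE.
  set d := (_ ^+ k)%:~R; ring.
have TD : ((p ^ 2)%N %| T - l * D)%Z.
  rewrite -intr_Zp_eq0 // rmorphB rmorphM /= -clear_den.
    rewrite /l pE sum_lucas_cbin -?pE // ?subrr // => [|x ux].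
      by rewrite -natrX pchar_Zp.
    have [w ew] := fermat_Zp2 p x p_prime ux; exists w; rewrite -ew.
    by congr (_ ^+ _); rewrite [in RHS]pE.
  apply: (intr_unit _ (p ^ 2)); first by rewrite pchar_Zp.
  by rewrite coprimez_sym coprimezE /= coprime_pexpl.
have D0 : D%:~R != 0 :> rat.
  rewrite intr_eq0 expf_neq0 //; apply: contraNneq pNAB => e.
  by move/eqP: e; rewrite mulf_eq0 /= => /eqP ->; rewrite mulr0 dvdz0.
set S := \sum_(_ <= _ < _) _; have SD : S * D%:~R = T%:~R.
  apply: clear_den; rewrite unitfE; apply: contra_neq D0 => e.
  by rewrite rmorphXn /= e expr0n; case: (p) p2 => [|[]].
have [z ez] := dvdzP TD.
(* The quotient comes from [T - l D = z p^2], where [D] is prime to [p]. *)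
split; [exact: plocal_frac SD | exact: plocal_int | exists (z%:~R / D%:~R)].
  by apply: (@plocal_frac p _ D z cpD); rewrite divfK.
apply: (mulIf D0); rewrite mulrBl SD -mulrA divfK // -rmorphM -rmorphB ez.
by rewrite rmorphM mulrC.
Qed.
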